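(* Let $n\ge1$, let $a_{i,j},b_{i,j}>0$ for $0\le i\le n-1$, $j\in\mathbb Z$, and let $V=M_0\Psi M_2\Psi M_4\Psi\cdots M_{2n-2}\Psi$ and $G=VS^{-n}$. Let $$L^{(1)}=X_0^{(0)}\Psi X_0^{(1)}\Psi X_0^{(2)}\Psi\cdots X_0^{(n-1)}\Psi,\qquad U^{(1)}=M_0^{(n)}M_2^{(n-1)}\cdots M_{2(n-1)}^{(1)}S^{-n},$$ where the matrices $X_0^{(j)}$ and $M_{2i}^{(j)}$ are obtained from the weights by the iteration described in the context. Then $L^{(1)}$ is lower triangular, $U^{(1)}$ is upper triangular, and $G=VS^{-n}=L^{(1)}U^{(1)}$.
   Context: All matrices are indexed by $\mathbb Z\times\mathbb Z$. $S$ is the shift, $S_{ij}=1$ if $i=j+1$ and $0$ otherwise; $\Psi=\sum_{k\ge0}S^k$; $D(\mathtt a)$ is the diagonal matrix with entries of $\mathtt a=(\mathtt a_j)_{j\in\mathbb Z}$. Write $\mathtt a_i=(a_{i,j})_j$, $\mathtt b_i=(b_{i,j})_j$ and $M_{2i}=D(\mathtt a_i)+D(\mathtt b_i)S$. Iteration: $(\mathtt a_i^{(0)},\mathtt b_i^{(0)})=(\mathtt a_i,\mathtt b_i)$ for $0\le i\le n-1$. For $j=1,\dots,n$ and $k\in\mathbb Z$: for $0\le i\le n-j-1$, $$a^{(j)}_{i,k}=a^{(j-1)}_{i,k}\frac{a^{(j-1)}_{i+1,k}+b^{(j-1)}_{i+1,k}}{a^{(j-1)}_{i,k}+b^{(j-1)}_{i,k}},\qquad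 b^{(j)}_{i,k}=b^{(j-1)}_{i,k-1}\frac{a^{(j-1)}_{i+1,k-1}+b^{(j-1)}_{i+1,k-1}}{a^{(j-1)}_{i,k-1}+b^{(j-1)}_{i,k-1}},$$ and for $i=n-j$, $$a^{(j)}_{n-j,k}=\frac{a^{(j-1)}_{n-j,k}}{a^{(j-1)}_{n-j,k}+b^{(j-1)}_{n-j,k}},\qquad b^{(j)}_{n-j,k}=\frac{b^{(j-1)}_{n-j,k-1}}{a^{(j-1)}_{n-j,k-1}+b^{(j-1)}_{n-j,k-1}}.$$ Set $M_{2i}^{(j)}=D(\mathtt a_i^{(j)})+D(\mathtt b_i^{(j)})S$ and $X_i^{(j-1)}=D(\mathtt a_i^{(j-1)}+\mathtt b_i^{(j-1)})$ for $0\le i\le n-j$. *)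

(* Defs.v *)
From HB Require Import structures.
From mathcomp Require Import all_boot all_order all_algebra.
From mathcomp Require Import mathcomp_extra boolp classical_sets functions.
From mathcomp Require Import cardinality fsbigop reals.
From mathcomp Require Import zify.

Set Implicit Arguments.
Unset Strict Implicit.
Unset Printing Implicit Defensive.

Import Order.TTheory GRing.Theory Num.Theory.
Local Open Scope classical_set_scope.
Local Open Scope ring_scope.

Definition zmx (R : Type) := int -> int -> R.

Section ZMatrix.
Variable R : realType.
Implicit Types (A B : zmx R) (n : nat).

Definition lower_triangular A := forall i j, i < j -> A i j = 0.
Definition upper_triangular A := forall i j, j < i -> A i j = 0.

Definition zmx1 : zmx R := fun i j => (i == j)%:R.
Definition zmx_add A B : zmx R := fun i j => A i j + B i j.

(* The sum is 0 by convention when infinitely many terms are nonzero. By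
   [lower_band_finite] and [lower_band_mul] this never happens in the products
   considered here: all factors vanish far enough above the diagonal. *)
Definition zmx_mul A B : zmx R :=
  fun i j => \sum_(k \in [set: int]) A i k * B k j.

Definition zmx_exp A n : zmx R := iter n (zmx_mul A) zmx1.
Definition zmx_diag (d : int -> R) : zmx R :=
  fun i j => if i == j then d i else 0.

Definition shift : zmx R := fun i j => (i == j + 1)%:R.

(* the two-sided inverse of [shift], see [shiftK] and [shiftVK] *)
Definition shiftV : zmx R := fun i j => (j == i + 1)%:R.

Definition Psi : zmx R :=
  fun i j => \sum_(k \in [set: nat]) zmx_exp shift k i j.

Definition bidiag (a b : int -> R) : zmx R :=
  zmx_add (zmx_diag a) (zmx_mul (zmx_diag b) shift).

(* One step of the iteration, from the weights of level [j.-1] to those of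
   level [j]. Level [j] has indices [i <= n - j]; the families are extended
   by 0 to the other [i]. *)
Definition weight_step n j (w : (nat -> int -> R) * (nat -> int -> R)) :
    (nat -> int -> R) * (nat -> int -> R) :=
  let: (a, b) := w in
  let s i k := a i k + b i k in
  ((fun i k => if (i + j < n)%N then a i k * (s i.+1 k / s i k)
               else if (i + j == n)%N then a i k / s i k
               else 0),
   (fun i k => if (i + j < n)%N then
                 b i (k - 1) * (s i.+1 (k - 1) / s i (k - 1))
               else if (i + j == n)%N then b i (k - 1) / s i (k - 1)
               else 0)).

Fixpoint weights n (a b : nat -> int -> R) j :
    (nat -> int -> R) * (nat -> int -> R) :=
  if j is j'.+1 then weight_step n j (weights n a b j') else (a, b).

Section Factors.
Variables (n : nat) (a b : nat -> int -> R).

Definition wa j := (weights n a b j).1.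
Definition wb j := (weights n a b j).2.

(* [M_even i j] is $M_{2i}^{(j)}$; $M_{2i}$ is [M_even i 0]. *)
Definition M_even i j : zmx R := bidiag (wa j i) (wb j i).
Definition X_diag i j : zmx R := zmx_diag (fun k => wa j i k + wb j i k).

Definition V_mx : zmx R :=
  \big[zmx_mul/zmx1]_(0 <= i < n) zmx_mul (M_even i 0) Psi.
Definition G_mx : zmx R := zmx_mul V_mx (zmx_exp shiftV n).
Definition L1_mx : zmx R :=
  \big[zmx_mul/zmx1]_(0 <= j < n) zmx_mul (X_diag 0 j) Psi.
Definition U1_mx : zmx R :=
  zmx_mul (\big[zmx_mul/zmx1]_(0 <= i < n) M_even i (n - i))
          (zmx_exp shiftV n).

End Factors.

Definition lower_band (c : nat) A := forall i j, i + c%:Z < j -> A i j = 0.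

Lemma lower_band_finite c d A B i j : lower_band c A -> lower_band d B ->
  finite_set [set k | A i k * B k j != 0].
Proof.
move=> Ac Bd; pose N := (c + d + `|i - j|)%N.
apply: (@sub_finite_set _ _
  ((fun m : nat => m%:Z + (j - d%:Z)) @` [set m | (m < N.+1)%N])); last first.
  exact/finite_image/finite_II.
move=> k /= ABk.
have ki : k <= i + c%:Z.
  by rewrite leNgt; apply: contra ABk => /Ac->; rewrite mul0r.
have jk : j <= k + d%:Z.
  by rewrite leNgt; apply: contra ABk => /Bd->; rewrite mulr0.
by exists (absz (k - (j - d%:Z))%R) => /=; lia.
Qed.

Lemma lower_band_mul c d A B : lower_band c A -> lower_band d B ->
  lower_band (c + d) (zmx_mul A B).
Proof.
move=> Ac Bd i j ij; apply: fsbig1 => k _.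
have [ik|ki] := ltP (i + c%:Z) k; first by rewrite Ac ?mul0r.
by rewrite Bd ?mulr0//; lia.
Qed.

Lemma fsum_one (I : choiceType) (x : I) (F : I -> R) :
  (forall k, k != x -> F k = 0) -> \sum_(k \in [set: I]) F k = F x.
Proof.
move=> F0; rewrite -(fsbig_widen [set x]) ?fsbig_set1// => k [_ /= /eqP kx].
exact: F0.
Qed.

Lemma zmx_mul_shiftl A i j : zmx_mul shift A i j = A (i - 1) j.
Proof.
rewrite /zmx_mul (fsum_one (x := i - 1)) => [|k ki]; rewrite /shift.
  by rewrite subrK eqxx mul1r.
by case: eqP => [?|_]; [lia|rewrite mul0r].
Qed.

Lemma zmx_mul_shiftVl A i j : zmx_mul shiftV A i j = A (i + 1) j.
Proof.
rewrite /zmx_mul (fsum_one (x := i + 1)) => [|k ki]; rewrite /shiftV.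
  by rewrite eqxx mul1r.
by case: eqP => [?|_]; [lia|rewrite mul0r].
Qed.

Lemma shiftK : zmx_mul shiftV shift = zmx1.
Proof.
apply/funext => i; apply/funext => j; rewrite zmx_mul_shiftVl /shift /zmx1.
by congr (_%:R); lia.
Qed.

Lemma shiftVK : zmx_mul shift shiftV = zmx1.
Proof.
apply/funext => i; apply/funext => j; rewrite zmx_mul_shiftl /shiftV /zmx1.
by congr (_%:R); lia.
Qed.

Lemma shift_expE k i j : zmx_exp shift k i j = (i == j + k%:Z)%:R.
Proof.
elim: k i => [|k IH] i; first by rewrite addr0.
by rewrite /zmx_exp iterS -/(zmx_exp _ k) zmx_mul_shiftl IH; congr (_%:R); lia.
Qed.

Lemma shiftV_expE k i j : zmx_exp shiftV k i j = (j == i + k%:Z)%:R.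
Proof.
elim: k i => [|k IH] i; first by rewrite addr0 /= /zmx1 eq_sym.
by rewrite /zmx_exp iterS -/(zmx_exp _ k) zmx_mul_shiftVl IH; congr (_%:R); lia.
Qed.

Lemma PsiE i j : Psi i j = (j <= i)%R%:R.
Proof.
rewrite /Psi (fsum_one (x := absz (i - j)%R)) => [|k ki]; rewrite shift_expE.
  by congr (_%:R); lia.
by case: eqP => // ?; lia.
Qed.

Lemma bidiagE a b i j :
  bidiag a b i j = if i == j then a i else if i == j + 1 then b i else 0.
Proof.
rewrite /bidiag /zmx_add /zmx_mul (fsum_one (x := i)) => [|k ki]; last first.
  by rewrite /zmx_diag eq_sym (negPf ki) mul0r.
rewrite /zmx_diag /shift eqxx; case: (i =P j) => [->|_].
  by case: eqP => [?|_]; [lia|rewrite mulr0 addr0].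
by case: eqP => _; rewrite ?mulr1 ?mulr0 add0r.
Qed.

End ZMatrix.

(* Main.v *)
From HB Require Import structures.
Require Import Defs.
From mathcomp Require Import all_boot all_order all_algebra.
From mathcomp Require Import boolp classical_sets fsbigop reals.
From mathcomp Require Import zify ring.
Set Implicit Arguments.
Unset Strict Implicit.
Unset Printing Implicit Defensive.

Import Order.TTheory GRing.Theory Num.Theory.
Local Open Scope ring_scope.

(** The theorem is the iteration of one commutation rule.  Write [s = a + b]
    and [q = b / s].  Since [Psi] is the inverse of [1 - S],
<<
      (D(a) + D(b) S) Psi = D(s) Psi - D(b),
      Psi (D(1 - q) + S D(q)) = Psi - D(q),
>>
    so [D(s)] times the second left-hand side is the first one.  Multiplying by
    [D(s')] on the right gives, for every sequence [s'],
<<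
      (D(a) + D(b) S) Psi D(s') = D(s) Psi (D(a') + D(b') S),
      a'_k = a_k s'_k / s_k,    b'_k = b_(k-1) s'_(k-1) / s_(k-1):
>>
    a diagonal matrix moves from the right to the left of a block [M Psi] at
    the cost of changing the weights of [M] ([bidiag_Psi_diag]).  Level [j] of
    the iteration is the case in which [s'] is the sum of the weights of the
    next block, or [1] for the last block.

    Start from the last block at level [t] with [s' = 1]; the diagonal factor
    that appears on its left is the one that the preceding block absorbs, and
    so on down to the first block ([sweep]).  One such sweep extracts
    [X_0^(t) Psi] on the left and leaves on the right a factor
    [M_(2(n-t-1))^(t+1)] that is no longer followed by [Psi]
    ([sweep_blocks]).  After [n] sweeps there only remain [L1] and the product
    of the [M_(2i)^(n-i)] ([V_sweeps]).

    Products of matrices indexed by the integers are not associative in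
    general.  They are on the matrices that vanish far enough above the
    diagonal, so the computation takes place in the monoid [bmx] of these
    matrices.  Triangularity is a count of diagonals: [L1] is a product of
    lower triangular factors, and each of the [n] bidiagonal factors of [U1]
    has one diagonal below the main one, which the shift by [-n] moves up. *)

(** * The monoid of matrices with a bounded upper part *)

Section Banded.
Variable R : realType.
Implicit Types A B C : zmx R.

(** Turns the entries of a product into sums over ['I_N]; the freedom in the
    window [p - N < k <= p] lets all the sums of a triple product use the same
    one. *)
Lemma zmx_mul_window c d A B (p : int) (N : nat) (i j : int) :
    lower_band c A -> lower_band d B ->
    i + c%:Z <= p -> p - N%:Z < j - d%:Z ->
  zmx_mul A B i j = \sum_(m < N) A i (p - m%:Z) * B (p - m%:Z) j.
Proof.
move=> Ac Bd ip pj; rewrite /zmx_mul; pose f (m : nat) : int := p - m%:Z.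
rewrite (fsbig_ord _ N (fun m => A i (f m) * B (f m) j)).
rewrite -(fsbig_widen (f @` `I_N)%classic) //; last first.
  move=> /= k [_ kN]; have [kp|kp] := leP k (i + c%:Z); last first.
    by rewrite Ac ?mul0r.
  have [jk|kj] := leP (j - d%:Z) k; last by rewrite Bd ?mulr0 //; lia.
  by case: kN; exists (absz (p - k)%R); rewrite /f /=; lia.
rewrite (reindex_fsbig f `I_N%classic) //.
split; [by move=> m mN; exists m| |by []].
by move=> m m' _ _; rewrite /f => H; lia.
Qed.

Definition banded A := exists c, lower_band c A.

Lemma banded_mul A B : banded A -> banded B -> banded (zmx_mul A B).
Proof. by move=> [c Ac] [d Bd]; exists (c + d)%N; apply: lower_band_mul. Qed.

Lemma zmx_mulA A B C : banded A -> banded B -> banded C ->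
  zmx_mul A (zmx_mul B C) = zmx_mul (zmx_mul A B) C.
Proof.
move=> [c Ac] [d Bd] [e Ce]; apply/funext => i; apply/funext => j.
pose p := i + c%:Z + d%:Z.
pose N := (absz (p - (j - d%:Z - e%:Z))%R).+1.
have ABcd := lower_band_mul Ac Bd; have BCde := lower_band_mul Bd Ce.
have pN : p - N%:Z < j - d%:Z - e%:Z by lia.
rewrite (@zmx_mul_window _ _ _ _ p N i j Ac BCde); [|lia|lia].
rewrite (@zmx_mul_window _ _ _ _ p N i j ABcd Ce); [|lia|lia].
under [RHS]eq_bigr => m _.
  (* when the column [p - m] is too small for the window to hold every term
     of the inner product, the last factor vanishes *)
  rewrite (_ : _ * _ = \sum_(l < N)
     A i (p - l%:Z) * B (p - l%:Z) (p - m%:Z) * C (p - m%:Z) j); last first.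
    have [mj|jm] := ltP (p - m%:Z + e%:Z) j.
      by rewrite Ce // mulr0 big1 // => l _; rewrite mulr0.
    rewrite (@zmx_mul_window _ _ _ _ p N _ _ Ac Bd); [|lia|lia].
    by rewrite mulr_suml.
  over.
rewrite exchange_big /=; apply: eq_bigr => l _.
have [il|li] := ltP (i + c%:Z) (p - l%:Z).
  by rewrite Ac // mul0r big1 // => m _; rewrite !mul0r.
rewrite (@zmx_mul_window _ _ _ _ p N _ _ Bd Ce); [|lia|lia].
by rewrite mulr_sumr; apply: eq_bigr => m _; rewrite mulrA.
Qed.

Lemma zmx_mul_diagl d A i j : zmx_mul (zmx_diag d) A i j = d i * A i j.
Proof.
rewrite /zmx_mul (fsum_one (x := i)) /zmx_diag ?eqxx // => k ki.
by rewrite eq_sym (negPf ki) mul0r.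
Qed.

Lemma zmx_mul_diagr d A i j : zmx_mul A (zmx_diag d) i j = A i j * d j.
Proof.
rewrite /zmx_mul (fsum_one (x := j)) /zmx_diag ?eqxx // => k kj.
by rewrite (negPf kj) mulr0.
Qed.

Lemma zmx1_diag : zmx1 R = zmx_diag (fun=> 1).
Proof.
by apply/funext => i; apply/funext => j; rewrite /zmx1 /zmx_diag; case: eqP.
Qed.

Lemma zmx_mul1l A : zmx_mul (zmx1 R) A = A.
Proof.
by apply/funext => i; apply/funext => j; rewrite zmx1_diag zmx_mul_diagl mul1r.
Qed.

Lemma zmx_mul1r A : zmx_mul A (zmx1 R) = A.
Proof.
by apply/funext => i; apply/funext => j; rewrite zmx1_diag zmx_mul_diagr mulr1.
Qed.

Lemma lower_band_diag d : lower_band 0 (zmx_diag d : zmx R).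
Proof. by move=> i j ij; rewrite /zmx_diag ifF //; apply/eqP; lia. Qed.

Lemma lower_band_bidiag a b : lower_band 0 (bidiag a b : zmx R).
Proof. by move=> i j ij; rewrite bidiagE !ifF //; apply/eqP; lia. Qed.

Lemma lower_band_Psi : lower_band 0 (Psi R).
Proof. by move=> i j ij; rewrite PsiE; case: leP => //; lia. Qed.

Lemma lower_band_shiftV n : lower_band n (zmx_exp (shiftV R) n).
Proof. by move=> i j ij; rewrite shiftV_expE; case: eqP => //; lia. Qed.

(** Bundled so that the matrices form a monoid and the theory of iterated
    products in a monoid applies. *)
Record bmx := Bmx { bval : zmx R; bvalP : banded bval }.

Lemma bval_inj : injective bval.
Proof.
move=> [A pA] [B pB] /= AB; rewrite AB in pA *.
by congr Bmx; apply: Prop_irrelevance.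
Qed.

Lemma banded1 : banded (zmx1 R).
Proof. by exists 0%N; rewrite zmx1_diag; apply: lower_band_diag. Qed.

Definition bone := Bmx banded1.
Definition bmul (A B : bmx) := Bmx (banded_mul (bvalP A) (bvalP B)).
Definition bdiag d := Bmx (ex_intro _ 0%N (lower_band_diag d)).
Definition bbidiag a b := Bmx (ex_intro _ 0%N (lower_band_bidiag a b)).
Definition bPsi := Bmx (ex_intro _ 0%N lower_band_Psi).
Definition bshiftV n := Bmx (ex_intro _ n (@lower_band_shiftV n)).

Lemma bmulA : associative bmul.
Proof. by move=> A B C; apply/bval_inj/zmx_mulA; apply: bvalP. Qed.

Lemma bmul1l : left_id bone bmul.
Proof. by move=> A; apply/bval_inj/zmx_mul1l. Qed.

Lemma bmul1r : right_id bone bmul.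
Proof. by move=> A; apply/bval_inj/zmx_mul1r. Qed.

HB.instance Definition _ := Monoid.isLaw.Build bmx bone bmul bmulA bmul1l bmul1r.

Lemma bval_big (I : Type) (r : seq I) (F : I -> bmx) :
  bval (\big[bmul/bone]_(i <- r) F i) =
  \big[@zmx_mul R/zmx1 R]_(i <- r) bval (F i).
Proof. by apply: (big_morph bval). Qed.

Lemma bdiag1 : bdiag (fun=> 1) = bone.
Proof. by apply: bval_inj; rewrite /= zmx1_diag. Qed.

End Banded.

(** * Triangularity *)

Section Triangular.
Variable R : realType.
Implicit Types A B : zmx R.

Lemma lower_triangular_band A : lower_triangular A <-> lower_band 0 A.
Proof. by split=> H i j ij; apply: H; lia. Qed.

Lemma lower_triangular_big (I : Type) (r : seq I) (F : I -> zmx R) :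
  (forall i, lower_triangular (F i)) ->
  lower_triangular (\big[@zmx_mul R/zmx1 R]_(i <- r) F i).
Proof.
move=> Fl; apply/lower_triangular_band; apply: (big_ind (lower_band 0)).
- by rewrite zmx1_diag; apply: lower_band_diag.
- by move=> A B A0 B0; rewrite -[0%N]addn0; apply: lower_band_mul.
- by move=> i _; apply/lower_triangular_band.
Qed.

Definition upper_band (c : nat) A := forall i j, j + c%:Z < i -> A i j = 0.

Lemma upper_band_mul c d A B : upper_band c A -> upper_band d B ->
  upper_band (c + d) (zmx_mul A B).
Proof.
move=> Ac Bd i j ij; apply: fsbig1 => k _.
have [ki|ik] := ltP (k + c%:Z) i; first by rewrite Ac ?mul0r.
by rewrite Bd ?mulr0 //; lia.
Qed.

Lemma upper_band_bidiag a b : upper_band 1 (bidiag a b : zmx R).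
Proof. by move=> i j ij; rewrite bidiagE !ifF //; apply/eqP; lia. Qed.

Lemma upper_band_big (I : Type) (r : seq I) (F : I -> zmx R) :
  (forall i, upper_band 1 (F i)) ->
  upper_band (size r) (\big[@zmx_mul R/zmx1 R]_(i <- r) F i).
Proof.
move=> F1; elim: r => [|x r IH] /=.
  by rewrite big_nil => i j ij; rewrite /zmx1; case: eqP => //; lia.
by rewrite big_cons; apply: (upper_band_mul (F1 x) IH).
Qed.

Lemma upper_triangular_mul_shiftV n A :
  upper_band n A -> upper_triangular (zmx_mul A (zmx_exp (shiftV R) n)).
Proof.
move=> An i j ji; apply: fsbig1 => k _; rewrite shiftV_expE.
by case: eqP => jk; [rewrite An ?mul0r //; lia|rewrite mulr0].
Qed.

End Triangular.

(** * Commuting a diagonal matrix through a block *)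

Section Exchange.
Variable R : realType.

Lemma zmx_mul_bidiagl a b (A : zmx R) i j :
  zmx_mul (bidiag a b) (A : zmx R) i j = a i * A i j + b i * A (i - 1) j.
Proof.
rewrite /zmx_mul -(fsbig_widen [set i; i - 1]%classic) //.
  rewrite fsbigU ?fsbig_set1 //=.
    by rewrite !bidiagE eqxx ifF ?ifT //; apply/eqP; lia.
  by move=> k /= [-> ?]; lia.
move=> k [_ /= kI]; rewrite bidiagE ifF ?ifF ?mul0r //.
  by apply/eqP => ?; apply: kI; right; lia.
by apply/eqP => ?; apply: kI; left.
Qed.

Lemma zmx_mul_bidiagr a b (A : zmx R) i j :
  zmx_mul A (bidiag a b) i j = A i j * a j + A i (j + 1) * b (j + 1).
Proof.
rewrite /zmx_mul -(fsbig_widen [set j; j + 1]%classic) //.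
  rewrite fsbigU ?fsbig_set1 //=.
    by rewrite !bidiagE !eqxx ifF //; apply/eqP; lia.
  by move=> k /= [-> ?]; lia.
move=> k [_ /= kI]; rewrite bidiagE ifF ?ifF ?mulr0 //.
  by apply/eqP => ?; apply: kI; right; lia.
by apply/eqP => ?; apply: kI; left; lia.
Qed.

(** Both sides are lower triangular.  Below the diagonal the two weights in a
    row of the bidiagonal factor on the left add up to [s], the two weights in
    a column of the one on the right add up to [s'], and both sides are
    [s i * s' j].  On the diagonal only [a] and its transform contribute. *)
Lemma bidiag_Psi_diag (a b s' : int -> R) :
    (forall k, a k + b k != 0) ->
  bmul (bmul (bbidiag a b) (bPsi R)) (bdiag s') =
  bmul (bmul (bdiag (fun k => a k + b k)) (bPsi R))
       (bbidiag (fun k => a k * (s' k / (a k + b k)))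
          (fun k => b (k - 1) * (s' (k - 1) / (a (k - 1) + b (k - 1))))).
Proof.
move=> s0; apply: bval_inj => /=; apply/funext => i; apply/funext => j.
rewrite zmx_mul_diagr zmx_mul_bidiagl zmx_mul_bidiagr !zmx_mul_diagl !PsiE.
rewrite addrK; have := s0 j; have := s0 i.
have [ij|ji|->] := ltgtP i j => si sj.
- have -> : (j <= i - 1) = false by lia.
  have -> : (j + 1 <= i) = false by lia.
  by rewrite !mulr0 !mul0r !addr0 mul0r.
- have -> : (j <= i - 1) = true by lia.
  have -> : (j + 1 <= i) = true by lia.
  by field.
- have -> : (j <= j - 1) = false by lia.
  have -> : (j + 1 <= j) = false by lia.
  by field.
Qed.

End Exchange.

(** * Sweeping through a product of blocks *)

Section Sweep.
Variables (T : Type) (e : T) (op : Monoid.law e).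
Local Notation "x ** y" := (op x y) (at level 40, left associativity).
Local Notation "\mul_ ( m <= i < n ) F" := (\big[op/e]_(m <= i < n) F)
  (at level 36, F at level 36, i, m, n at level 50).

Let opA : associative op := @Monoid.mulmA T op.

Lemma big_swap_bracket (P : T) (F : nat -> T) m :
  (\mul_(0 <= i < m) (P ** F i)) ** P = P ** \mul_(0 <= i < m) (F i ** P).
Proof.
elim: m => [|m IH]; first by rewrite !big_geq // Monoid.mul1m Monoid.mulm1.
by rewrite !big_nat_recr //= !opA IH.
Qed.

(** The rightmost [X m] passes through every block, losing one in its index
    each time. *)
Lemma sweep (P : T) (M M' X : nat -> T) m :
    (forall i, (i < m)%N -> M i ** P ** X i.+1 = X i ** P ** M' i) ->
  (\mul_(0 <= i < m) (M i ** P)) ** X m =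
  X 0%N ** \mul_(0 <= i < m) (P ** M' i).
Proof.
elim: m => [|m IH] H; first by rewrite !big_geq // Monoid.mul1m Monoid.mulm1.
rewrite !big_nat_recr //= -opA H // !opA IH // => i im.
by apply: H; rewrite ltnW.
Qed.

(** The last block starts the sweep: it produces [X m] out of nothing. *)
Lemma sweep_blocks (P : T) (M M' X : nat -> T) m :
    (forall i, (i < m)%N -> M i ** P ** X i.+1 = X i ** P ** M' i) ->
    M m ** P = X m ** P ** M' m ->
  \mul_(0 <= i < m.+1) (M i ** P) =
  X 0%N ** P ** (\mul_(0 <= i < m) (M' i ** P)) ** M' m.
Proof.
move=> HX Hm; rewrite big_nat_recr //= Hm !opA (sweep HX).
by rewrite -[X 0%N ** _ ** P]opA big_swap_bracket opA.
Qed.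

End Sweep.

(** * The iterated weights and the factorization *)

Section Factorization.
Variables (R : realType) (n : nat) (a b : nat -> int -> R).
Hypothesis ha : forall i j, (i < n)%N -> 0 < a i j.
Hypothesis hb : forall i j, (i < n)%N -> 0 < b i j.
Local Notation wa := (wa n a b).
Local Notation wb := (wb n a b).

Lemma waS j i k : wa j.+1 i k =
  if (i + j.+1 < n)%N
  then wa j i k * ((wa j i.+1 k + wb j i.+1 k) / (wa j i k + wb j i k))
  else if (i + j.+1 == n)%N then wa j i k / (wa j i k + wb j i k) else 0.
Proof. by rewrite /Defs.wa /Defs.wb /=; case: (weights _ _ _ _). Qed.

Lemma wbS j i k : wb j.+1 i k =
  if (i + j.+1 < n)%N
  then wb j i (k - 1) * ((wa j i.+1 (k - 1) + wb j i.+1 (k - 1)) /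
                         (wa j i (k - 1) + wb j i (k - 1)))
  else if (i + j.+1 == n)%N
       then wb j i (k - 1) / (wa j i (k - 1) + wb j i (k - 1)) else 0.
Proof. by rewrite /Defs.wa /Defs.wb /=; case: (weights _ _ _ _). Qed.

(** Positivity serves to divide by the sums of the weights; it has to be
    carried along because level [j.+1] divides by the sums of level [j]. *)
Lemma weights_gt0 j i k : (i + j <= n)%N -> (i < n)%N ->
  0 < wa j i k /\ 0 < wb j i k.
Proof.
elim: j i k => [|j IH] i k ijn iltn; first by split; [apply: ha|apply: hb].
have H0 k' : 0 < wa j i k' /\ 0 < wb j i k' by apply: IH => //; lia.
have S0 k' : 0 < wa j i k' + wb j i k' by case: (H0 k') => *; apply: addr_gt0.
rewrite waS wbS; case: ltngtP ijn => // ijn _.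
  have S1 k' : 0 < wa j i.+1 k' + wb j i.+1 k'.
    by case: (IH i.+1 k') => *; [lia|lia|apply: addr_gt0].
  by split; rewrite mulr_gt0 ?divr_gt0 //; [case: (H0 k)|case: (H0 (k - 1))].
by split; rewrite divr_gt0 //; [case: (H0 k)|case: (H0 (k - 1))].
Qed.

Lemma weights_sum_neq0 j i k : (i + j < n)%N -> wa j i k + wb j i k != 0.
Proof.
move=> ijn; case: (@weights_gt0 j i k) => [||wa0 wb0]; [lia|lia|].
by rewrite gt_eqF // addr_gt0.
Qed.

Definition bM i j := bbidiag (wa j i) (wb j i).
Definition bX i j := bdiag (fun k => wa j i k + wb j i k).

Lemma bM_Psi_bX i j : (i + j.+1 < n)%N ->
  bmul (bmul (bM i j) (bPsi R)) (bX i.+1 j) =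
  bmul (bmul (bX i j) (bPsi R)) (bM i j.+1).
Proof.
move=> ijn; rewrite bidiag_Psi_diag => [|k]; last by apply: weights_sum_neq0; lia.
congr bmul; rewrite /bM; congr bbidiag; apply/funext => k.
  by rewrite waS ijn.
by rewrite wbS ijn.
Qed.

Lemma bM_Psi_last i j : (i + j.+1 = n)%N ->
  bmul (bM i j) (bPsi R) = bmul (bmul (bX i j) (bPsi R)) (bM i j.+1).
Proof.
move=> ijn; rewrite -[LHS]bmul1r -bdiag1 bidiag_Psi_diag => [|k]; last first.
  by apply: weights_sum_neq0; lia.
congr bmul; rewrite /bM; congr bbidiag; apply/funext => k.
  by rewrite waS ijn ltnn eqxx div1r.
by rewrite wbS ijn ltnn eqxx div1r.
Qed.

(** The state after [t] sweeps.  Each sweep detaches the last remaining block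
    from its [Psi], so the block [i] is frozen at the level [n - i] at which
    this happens. *)
Lemma V_sweeps t : (t <= n)%N ->
  \big[@bmul R/bone R]_(0 <= i < n) bmul (bM i 0) (bPsi R) =
  bmul (bmul (\big[@bmul R/bone R]_(0 <= j < t) bmul (bX 0 j) (bPsi R))
             (\big[@bmul R/bone R]_(0 <= i < n - t) bmul (bM i t) (bPsi R)))
       (\big[@bmul R/bone R]_(n - t <= i < n) bM i (n - i)).
Proof.
elim: t => [|t IH] tn.
  by rewrite subn0 [X in bmul (bmul X _)]big_geq // [X in bmul _ X]big_geq //
             bmul1l bmul1r.
rewrite {}IH 1?ltnW //; set m := (n - t.+1)%N.
have -> : (n - t = m.+1)%N by rewrite /m; lia.
rewrite (@sweep_blocks _ _ (@bmul R) _ _ (bM^~ t.+1) (bX^~ t) m) => [|i im|].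
- rewrite [X in _ = bmul _ X]big_ltn; last by rewrite /m; lia.
  rewrite [in RHS]big_nat_recr //=.
  have -> : (n - m = t.+1)%N by rewrite /m subKn.
  by rewrite !bmulA.
- by apply: bM_Psi_bX; rewrite /m in im; lia.
- by apply: bM_Psi_last; rewrite /m; lia.
Qed.

Lemma G_factor : G_mx n a b = zmx_mul (L1_mx n a b) (U1_mx n a b).
Proof.
have := V_sweeps (leqnn n).
rewrite subnn [X in _ = bmul (bmul _ X) _]big_geq // bmul1r.
move/(congr1 (fun A => bval (bmul A (bshiftV R n)))); rewrite -bmulA /=.
by rewrite !bval_big.
Qed.

End Factorization.

Theorem lemma6p3 (R : realType) (n : nat) (a b : nat -> int -> R)
    (hn : (1 <= n)%N)
    (ha : forall (i : nat) (j : int), (i < n)%N -> 0 < a i j)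
    (hb : forall (i : nat) (j : int), (i < n)%N -> 0 < b i j) :
  [/\ lower_triangular (L1_mx n a b),
      upper_triangular (U1_mx n a b) &
      G_mx n a b = zmx_mul (L1_mx n a b) (U1_mx n a b)].
Proof.
split; last exact: G_factor.
- apply: lower_triangular_big => j; apply/lower_triangular_band.
  exact: (lower_band_mul (lower_band_diag _) (@lower_band_Psi R)).
- apply: upper_triangular_mul_shiftV.
  have := @upper_band_big R _ (index_iota 0 n) (fun i => M_even n a b i (n - i)).
  by rewrite size_iota subn0; apply=> i; apply: upper_band_bidiag.
Qed.
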